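(* Let $f:\mathbb{R}^N\to\mathbb{R}$ be differentiable with $L$-Lipschitz continuous gradient (with respect to $\|\cdot\|_2$) and $\mu$-strongly convex with $\mu\ge0$ ($\mu=0$ meaning convex), let $x_*$ be a minimizer of $f$, and let $R=\|x_*-x^0\|_2$. Let $n$ be the number of blocks of coordinates, and let $(x^k)$ be generated by the Accelerated Alternating Minimization algorithm described in the context, run with parameter $\mu$ from the starting point $x^0$. Then after $k\ge1$ iterations \[ f(x^k)-f(x_* )\;\le\; nLR^2\min\left\{\frac{4}{k^2},\ \Bigl(1-\sqrt{\frac{\mu}{nL}}\Bigr)^{k-1}\right\}. \]
   Context: The index set $\{1,\dots,N\}$ of the standard orthonormal basis $e_1,\dots,e_N$ of $\mathbb{R}^N$ is partitioned into $n$ disjoint blocks $I_1,\dots,I_n$. For $x\in\mathbb{R}^N$ put $S_i(x)=x+\operatorname{span}\{e_j: j\in I_i\}$, and let $\nabla_i f(x)$ denote the vector of partial derivatives of $f$ with respect to the coordinates in block $I_i$. It is assumed that $f$ can be minimized exactly over each $S_i(x)$. Accelerated Alternating Minimization algorithm with parameter $\mu\ge0$. Given $x^0\in\mathbb{R}^N$, set $v^0=x^0$, $A_0=0$, $\tau_0=1$, $\psi_0(x)=\frac12\|x-x^0\|_2^2$. For $k=0,1,2,\dots$: 1. $\beta_k\in\arg\min_{\beta\in[0,1]} f\bigl(x^k+\beta(v^k-x^k)\bigr)$, $y^k=x^k+\beta_k(v^k-x^k)$. 2. $i_k\in\arg\max_{i\in\{1,\dots,n\}}\|\nabla_i f(y^k)\|_2^2$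 and $x^{k+1}\in\arg\min_{x\in S_{i_k}(y^k)} f(x)$. 3. If $L$ is known, $a_{k+1}>0$ is found from $\frac{a_{k+1}^2}{(A_k+a_{k+1})(\tau_k+\mu a_{k+1})}=\frac1{Ln}$. If $L$ is not known, $a_{k+1}>0$ is found from $f(y^k)-\frac{a_{k+1}^2}{2(A_k+a_{k+1})(\tau_k+\mu a_{k+1})}\|\nabla f(y^k)\|_2^2+\frac{\mu\tau_k a_{k+1}}{2(A_k+a_{k+1})(\tau_k+\mu a_{k+1})}\|v^k-y^k\|_2^2=f(x^{k+1})$. 4. $A_{k+1}=A_k+a_{k+1}$, $\tau_{k+1}=\tau_k+\mu a_{k+1}$. 5. $\psi_{k+1}(x)=\psi_k(x)+a_{k+1}\{f(y^k)+\langle\nabla f(y^k),x-y^k\rangle+\frac\mu2\|x-y^k\|_2^2\}$ and $v^{k+1}=\arg\min_{x\in\mathbb{R}^N}\psi_{k+1}(x)$. The steps are assumed to be well defined; in the unknown-$L$ variant, determining $a_{k+1}$ from its equation presupposes $\nabla f(y^k)\neq0$ at the iterations considered. *)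

(* Defs.v *)
From HB Require Import structures.
From mathcomp Require Import all_boot all_order all_algebra.
From mathcomp Require Import all_classical all_reals all_analysis.

Set Implicit Arguments.
Unset Strict Implicit.
Unset Printing Implicit Defensive.

Import Order.TTheory GRing.Theory Num.Theory.
Import numFieldNormedType.Exports.

Local Open Scope classical_set_scope.
Local Open Scope ring_scope.

Definition dotv (R : realType) (N : nat) (u v : 'rV[R]_N) : R :=
  \sum_(j < N) u 0 j * v 0 j.

(* The library norm `|u| on 'rV[R]_N is the sup norm, not this one; the two
   induce the same topology, so differentiability is unaffected. *)
Definition norm2 (R : realType) (N : nat) (u : 'rV[R]_N) : R :=
  Num.sqrt (dotv u u).

Definition argmin (R : realType) (T : Type) (D : set T) (g : T -> R) : set T :=
  [set z | D z /\ forall w, D w -> g z <= g w].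

Definition argmax (R : realType) (T : Type) (D : set T) (g : T -> R) : set T :=
  [set z | D z /\ forall w, D w -> g w <= g z].

Definition grad (R : realType) (N : nat) (f : 'rV[R]_N -> R) (x : 'rV[R]_N) :
    'rV[R]_N :=
  \row_j 'D_(delta_mx 0 j) f x.

Definition lipschitz_grad (R : realType) (N : nat) (L : R)
    (f : 'rV[R]_N -> R) : Prop :=
  forall x y, norm2 (grad f x - grad f y) <= L * norm2 (x - y).

Definition strongly_convex (R : realType) (N : nat) (mu : R)
    (f : 'rV[R]_N -> R) : Prop :=
  forall (x y : 'rV[R]_N) (t : R), 0 <= t <= 1 ->
    f (t *: x + (1 - t) *: y) <=
      t * f x + (1 - t) * f y - mu / 2 * t * (1 - t) * norm2 (x - y) ^+ 2.

(* [finset.partition] (not the classical-set notion of the same name) makes the blocks nonempty and covering; injectivity of [I] then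
   makes blocks with distinct indices disjoint, so there are exactly n of them. *)
Definition block_partition (N n : nat) (I : 'I_n -> {set 'I_N}) : Prop :=
  injective I /\ finset.partition (I @: 'I_n) [set: 'I_N]%SET.

Definition block_grad (R : realType) (N n : nat) (I : 'I_n -> {set 'I_N})
    (i : 'I_n) (f : 'rV[R]_N -> R) (x : 'rV[R]_N) : 'rV[R]_#|I i| :=
  \row_(l < #|I i|) grad f x 0 (enum_val l).

Definition block_space (R : realType) (N n : nat) (I : 'I_n -> {set 'I_N})
    (i : 'I_n) (x : 'rV[R]_N) : set 'rV[R]_N :=
  [set z | z - x \in <<[seq (delta_mx 0%R j : 'rV[R]_N) | j <- enum (I i)]>>%VS].

Variant step_rule := KnownL | UnknownL.

(* [aam_a s] is read at positive indices only: a_{k+1} is [aam_a s k.+1]. *)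
Record aam_trace (R : realType) (N n : nat) := AamTrace {
  aam_x : nat -> 'rV[R]_N;
  aam_v : nat -> 'rV[R]_N;
  aam_y : nat -> 'rV[R]_N;
  aam_beta : nat -> R;
  aam_i : nat -> 'I_n;
  aam_a : nat -> R;
  aam_A : nat -> R;
  aam_tau : nat -> R;
  aam_psi : nat -> 'rV[R]_N -> R }.

Definition aam_init (R : realType) (N n : nat) (x0 : 'rV[R]_N)
    (s : aam_trace R N n) : Prop :=
  [/\ aam_x s 0 = x0,
      aam_v s 0 = x0,
      aam_A s 0 = 0,
      aam_tau s 0 = 1 &
      forall z, aam_psi s 0 z = 2^-1 * norm2 (z - x0) ^+ 2].

(* Equation determining the step size a = a_{k+1} from A = A_k, tau = tau_k,
   v = v^k, y = y^k and x' = x^{k+1}. *)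
Definition step_size_eq (R : realType) (N n : nat) (rule : step_rule)
    (f : 'rV[R]_N -> R) (L mu A tau a : R) (v y x' : 'rV[R]_N) : Prop :=
  match rule with
  | KnownL =>
      a ^+ 2 / ((A + a) * (tau + mu * a)) = 1 / (L * n%:R)
  | UnknownL =>
      grad f y <> 0 /\
      f y - a ^+ 2 / (2 * (A + a) * (tau + mu * a)) * norm2 (grad f y) ^+ 2
        + mu * tau * a / (2 * (A + a) * (tau + mu * a)) * norm2 (v - y) ^+ 2
      = f x'
  end.

Record aam_step (R : realType) (N n : nat) (I : 'I_n -> {set 'I_N})
    (rule : step_rule) (f : 'rV[R]_N -> R) (L mu : R)
    (s : aam_trace R N n) (k : nat) : Prop := AamStep {
  aam_step_beta :
    argmin [set b : R | 0 <= b <= 1]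
      (fun b => f (aam_x s k + b *: (aam_v s k - aam_x s k))) (aam_beta s k);
  aam_step_y :
    aam_y s k = aam_x s k + aam_beta s k *: (aam_v s k - aam_x s k);
  aam_step_i :
    argmax [set: 'I_n]
      (fun i => norm2 (block_grad I i f (aam_y s k)) ^+ 2) (aam_i s k);
  aam_step_x :
    argmin (block_space I (aam_i s k) (aam_y s k)) f (aam_x s k.+1);
  aam_step_a_gt0 : 0 < aam_a s k.+1;
  aam_step_a :
    step_size_eq n rule f L mu (aam_A s k) (aam_tau s k) (aam_a s k.+1)
      (aam_v s k) (aam_y s k) (aam_x s k.+1);
  aam_step_A : aam_A s k.+1 = aam_A s k + aam_a s k.+1;
  aam_step_tau : aam_tau s k.+1 = aam_tau s k + mu * aam_a s k.+1;
  aam_step_psi : forall z,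
    aam_psi s k.+1 z = aam_psi s k z + aam_a s k.+1 *
      (f (aam_y s k) + dotv (grad f (aam_y s k)) (z - aam_y s k)
       + mu / 2 * norm2 (z - aam_y s k) ^+ 2);
  aam_step_v :
    argmin [set: 'rV[R]_N] (aam_psi s k.+1) (aam_v s k.+1) }.

(* The first K iterations of the method; entries of [s] not produced by these
   iterations are unconstrained, so a run may stop after K iterations. *)
Definition aam_run (R : realType) (N n : nat) (I : 'I_n -> {set 'I_N})
    (rule : step_rule) (f : 'rV[R]_N -> R) (L mu : R) (x0 : 'rV[R]_N)
    (s : aam_trace R N n) (K : nat) : Prop :=
  aam_init x0 s /\
  forall k, (k < K)%N -> aam_step I rule f L mu s k.

(* Main.v *)
Require Import Defs.
From HB Require Import structures.
From mathcomp Require Import all_boot all_order all_algebra.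
From mathcomp Require Import all_classical all_reals all_analysis.
From mathcomp Require Import ring lra.

Set Implicit Arguments.
Unset Strict Implicit.
Unset Printing Implicit Defensive.

Import Order.TTheory GRing.Theory Num.Theory.
Import numFieldNormedType.Exports.

Local Open Scope classical_set_scope.
Local Open Scope ring_scope.

(* Estimate sequences. Each psi_k is a quadratic of curvature tau_k, so it equals
   psi_k(v^k) + tau_k/2 |z - v^k|^2. The exact line search gives
   f(y^k) <= f(x^k) and <grad f(y^k), v^k - y^k> >= 0; the greedy block choice and
   the descent lemma give f(x^{k+1}) <= f(y^k) - |grad f(y^k)|^2 / (2 L n).
   Completing the square then propagates A_k f(x^k) <= psi_k(v^k), while strong
   convexity gives psi_k(z) <= A_k f(z) + |z - x^0|^2 / 2; at a minimizer z = x* these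
   yield A_k (f(x^k) - min f) <= R^2 / 2. Both step size rules imply
   A_k tau_k <= L n a_k^2 with tau_k = 1 + mu A_k; keeping only the summand 1 of
   tau_k makes A_k grow quadratically, keeping only mu A_k makes it grow
   geometrically. *)

(** * Euclidean inner product and norm *)

Section InnerProduct.
Context {R : realType} {N : nat}.
Implicit Types (u v w : 'rV[R]_N) (a : R).

Lemma dotvC u v : dotv u v = dotv v u.
Proof. by apply: eq_bigr => j _; rewrite mulrC. Qed.

Lemma dotvDl u v w : dotv (u + v) w = dotv u w + dotv v w.
Proof. by rewrite -big_split; apply: eq_bigr => j _; rewrite mxE mulrDl. Qed.

Lemma dotvZl a u v : dotv (a *: u) v = a * dotv u v.
Proof. by rewrite /dotv mulr_sumr; apply: eq_bigr => j _; rewrite mxE mulrA. Qed.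

Lemma dotvDr u v w : dotv u (v + w) = dotv u v + dotv u w.
Proof. by rewrite dotvC dotvDl !(dotvC u). Qed.

Lemma dotvZr a u v : dotv u (a *: v) = a * dotv u v.
Proof. by rewrite dotvC dotvZl dotvC. Qed.

Lemma dotvNl u v : dotv (- u) v = - dotv u v.
Proof. by rewrite -scaleN1r dotvZl mulN1r. Qed.

Lemma dotvNr u v : dotv u (- v) = - dotv u v.
Proof. by rewrite dotvC dotvNl dotvC. Qed.

Definition dotvE := (dotvDl, dotvDr, dotvNl, dotvNr, dotvZl, dotvZr).

Lemma dotv_ge0 u : 0 <= dotv u u.
Proof. by apply: sumr_ge0 => j _; rewrite -expr2 sqr_ge0. Qed.

Lemma dotv_eq0 u : dotv u u = 0 -> u = 0.
Proof.
move=> u0; apply/rowP => j; rewrite mxE; apply/eqP.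
rewrite -(sqrf_eq0 (u 0 j)) expr2.
have /psumr_eq0P : forall i : 'I_N, true -> 0 <= u 0 i * u 0 i.
  by move=> i _; rewrite -expr2 sqr_ge0.
by move=> /(_ u0 j isT) ->.
Qed.

Lemma sqr_norm2 u : norm2 u ^+ 2 = dotv u u.
Proof. by rewrite sqr_sqrtr ?dotv_ge0. Qed.

Lemma norm2_ge0 u : 0 <= norm2 u.
Proof. exact: sqrtr_ge0. Qed.

Lemma norm2N u : norm2 (- u) = norm2 u.
Proof. by rewrite /norm2 dotvNl dotvNr opprK. Qed.

Lemma norm2Z a u : 0 <= a -> norm2 (a *: u) = a * norm2 u.
Proof.
move=> a0; rewrite /norm2 !dotvE mulrA -expr2 sqrtrM ?sqr_ge0 //.
by rewrite sqrtr_sqr ger0_norm.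
Qed.

Lemma cauchy_schwarz u v : dotv u v <= norm2 u * norm2 v.
Proof.
have [u0|u0] := eqVneq (norm2 u) 0.
  have -> : u = 0 by apply: dotv_eq0; rewrite -sqr_norm2 u0 expr0n.
  by rewrite -(scale0r 0) dotvZl mul0r mulr_ge0 ?norm2_ge0.
have [v0|v0] := eqVneq (norm2 v) 0.
  have -> : v = 0 by apply: dotv_eq0; rewrite -sqr_norm2 v0 expr0n.
  by rewrite -(scale0r 0) dotvZr mul0r mulr_ge0 ?norm2_ge0.
have up : 0 < norm2 u by rewrite lt_def u0 norm2_ge0.
have vp : 0 < norm2 v by rewrite lt_def v0 norm2_ge0.
have := dotv_ge0 (norm2 v *: u - norm2 u *: v).
rewrite !dotvE -!sqr_norm2 (dotvC v u) => h.
have {h} : 0 <= (norm2 u * norm2 v) * (norm2 u * norm2 v - dotv u v) by lra.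
by rewrite pmulr_rge0 ?mulr_gt0 // subr_ge0.
Qed.

End InnerProduct.

(** * Derivatives along lines and quadratic bounds from a Lipschitz gradient *)

Section Smooth.
Context {R : realType} {N : nat}.
Variable f : 'rV[R]_N -> R.
Hypothesis hdiff : forall x, differentiable f x.

Lemma derive_grad x d : 'D_d f x = dotv (grad f x) d.
Proof.
rewrite deriveE // {1}(row_sum_delta d) linear_sum /dotv.
by apply: eq_bigr => j _; rewrite linearZ /= mxE deriveE // mulrC.
Qed.

Lemma is_derive_line y d (t : R) :
  is_derive t 1 (fun u : R => f (y + u *: d)) (dotv (grad f (y + t *: d)) d).
Proof.
rewrite -derive_grad.
(* The difference quotients of the restriction at [t] are those of [f] at [y + t d] in direction
   [d]. *)
have E : (fun h : R => h^-1 *: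
    (((fun u : R => f (y + u *: d)) \o shift t) (h *: 1) - f (y + t *: d))) =
  (fun h : R => h^-1 *: ((f \o shift (y + t *: d)) (h *: d) - f (y + t *: d))).
  apply/funext => h /=; congr (_ *: (f _ - _)).
  by rewrite (mulr1 h : h *: 1 = h) scalerDl addrCA.
have D : derivable f (y + t *: d) d by exact: diff_derivable.
by split; rewrite /derivable /derive E.
Qed.

End Smooth.

(** The mean value theorem for [h] minus its quadratic model yields a point of []0, 1[] where the
    difference has nonpositive derivative; this stands in for integrating [dh]. *)
Lemma quadratic_upper_bound_line (R : realType) (h dh : R -> R) (M : R) :
  (forall t : R, is_derive t 1 h (dh t)) ->
  (forall t, 0 < t -> dh t <= dh 0 + M * t) ->
  h 1 <= h 0 + dh 0 + M / 2.
Proof.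
move=> hd hM.
pose q t := h t - (dh 0 * t + M / 2 * t ^+ 2).
have qd (t : R) : is_derive t 1 q (dh t - (dh 0 + M * t)).
  rewrite /q; apply: is_deriveB; apply: is_derive_eq.
  rewrite /GRing.scale /=; lra.
have [|t /[!in_itv]/= /andP[t0 _] e] := MVT (@ltr01 R) (fun t _ => qd t).
  apply: derivable_within_continuous => t _; exact: (@ex_derive _ _ _ _ _ _ _ (qd t)).
have := hM t t0; move: e; rewrite /q; lra.
Qed.

Section LipschitzGradient.
Context {R : realType} {N : nat}.
Variables (f : 'rV[R]_N -> R) (L : R).
Hypothesis hdiff : forall x, differentiable f x.
Hypothesis hlip : lipschitz_grad L f.

Lemma descent_upper y d :
  f (y + d) <= f y + dotv (grad f y) d + L / 2 * dotv d d.
Proof.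
have := quadratic_upper_bound_line (M := L * dotv d d) (is_derive_line hdiff y d).
rewrite scale1r scale0r addr0 mulrAC; apply => t t0.
rewrite -lerBlDl -dotvNl -dotvDl; apply: le_trans (cauchy_schwarz _ _) _.
apply: le_trans (ler_wpM2r (norm2_ge0 _) (hlip _ _)) _.
by rewrite addrC addKr (norm2Z _ (ltW t0)) -sqr_norm2; lra.
Qed.

(** The same line argument applied to [- f]; it controls the remainder in
    [strongly_convex_lower]. *)
Lemma descent_lower y d :
  f y + dotv (grad f y) d - L / 2 * dotv d d <= f (y + d).
Proof.
have hN (t : R) : is_derive t 1 (fun u : R => - f (y + u *: d))
    (- dotv (grad f (y + t *: d)) d).
  by apply: is_deriveN; exact: is_derive_line.
have := quadratic_upper_bound_line (M := L * dotv d d) hN.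
rewrite scale1r scale0r addr0 => H.
suff /H : forall t, 0 < t -> - dotv (grad f (y + t *: d)) d <=
    - dotv (grad f y) d + L * dotv d d * t by lra.
move=> t t0; rewrite -lerBlDl -opprD -dotvNl -dotvDl -dotvNl opprD opprK addrC.
apply: le_trans (cauchy_schwarz _ _) _.
apply: le_trans (ler_wpM2r (norm2_ge0 _) (hlip _ _)) _.
by rewrite opprD addNKr norm2N (norm2Z _ (ltW t0)) -sqr_norm2; lra.
Qed.

End LipschitzGradient.

(* This replaces the limits [t -> 0+] in first-order conditions: the quadratic
   bounds on [f] make the remainder explicit. *)
Lemma le_of_le_add_small (R : realFieldType) (c D M : R) :
  (forall t, 0 < t <= 1 -> c <= D + t * M) -> c <= D.
Proof.
move=> h; rewrite leNgt; apply/negP => Dc.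
have h1 := h 1; rewrite ltr01 lexx mul1r in h1; have {}h1 := h1 isT.
have M0 : 0 < M by lra.
(* At this [t] the remainder [t * M] is only half of [c - D]; the case [t = 1] gives [c - D <= M],
   hence [t <= 1]. *)
have := h ((c - D) / (2 * M)).
rewrite divr_gt0 ?mulr_gt0 ?subr_gt0 // ler_pdivrMr ?mulr_gt0 // => /(_ _)/wrap[|].
  lra.
have -> : (c - D) / (2 * M) * M = (c - D) / 2 by field; rewrite gt_eqF.
lra.
Qed.

(** * First-order conditions: strong convexity and minima along segments *)

Section StrongConvexity.
Context {R : realType} {N : nat}.
Variables (f : 'rV[R]_N -> R) (L : R).
Hypothesis hdiff : forall x, differentiable f x.
Hypothesis hlip : lipschitz_grad L f.

(** Sandwich [f (y + t d)] between [descent_lower] and the convexity inequality, then divide by [t]: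
    the error left is [t (L + mu) / 2 * |d|^2]. *)
Lemma strongly_convex_lower (mu : R) : strongly_convex mu f ->
  forall y z, f y + dotv (grad f y) (z - y) + mu / 2 * norm2 (z - y) ^+ 2 <= f z.
Proof.
move=> hconv y z; set d := z - y.
suff : dotv (grad f y) d + mu / 2 * norm2 d ^+ 2 <= f z - f y by lra.
apply: (le_of_le_add_small (M := (L / 2 + mu / 2) * dotv d d)) => t /andP[t0 t1].
have t01 : 0 <= t <= 1 by rewrite ltW.
have := descent_lower hdiff hlip y (t *: d); have := hconv z y t t01.
have -> : t *: z + (1 - t) *: y = y + t *: d.
  by rewrite /d scalerBl scalerBr scale1r addrCA addrA.
rewrite -/d !dotvZr dotvZl sqr_norm2 => h1 h2.
rewrite -(ler_pM2l t0); lra.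
Qed.

Lemma line_min_dotv_ge0 y d :
  (forall t, 0 <= t <= 1 -> f y <= f (y + t *: d)) -> 0 <= dotv (grad f y) d.
Proof.
move=> h; apply: (le_of_le_add_small (M := L / 2 * dotv d d)) => t /andP[t0 t1].
have := descent_upper hdiff hlip y (t *: d).
have := h t; rewrite ltW // t1 => /(_ isT).
by rewrite !dotvZr dotvZl => h1 h2; rewrite -(ler_pM2l t0) mulr0; lra.
Qed.

End StrongConvexity.

(** * Block gradients and exact block minimization *)

Section Blocks.
Context {R : realType} {N n : nat}.
Variable I : 'I_n -> {set 'I_N}.

Lemma sqr_norm2_block_grad (f : 'rV[R]_N -> R) i y :
  norm2 (block_grad I i f y) ^+ 2 = \sum_(j in I i) grad f y 0 j ^+ 2.
Proof.
rewrite sqr_norm2 /dotv [RHS]big_enum_val.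
by apply: eq_bigr => j _; rewrite !mxE expr2.
Qed.

Lemma sqr_norm2_grad_le (f : 'rV[R]_N -> R) i y : block_partition I ->
  argmax [set: 'I_n] (fun j => norm2 (block_grad I j f y) ^+ 2) i ->
  norm2 (grad f y) ^+ 2 <= n%:R * norm2 (block_grad I i f y) ^+ 2.
Proof.
move=> [Iinj Ipart] [_ imax].
have -> : norm2 (grad f y) ^+ 2 = \sum_j norm2 (block_grad I j f y) ^+ 2.
  under eq_bigr do rewrite sqr_norm2_block_grad.
  have -> : norm2 (grad f y) ^+ 2 = \sum_j grad f y 0 j ^+ 2.
    by rewrite sqr_norm2; apply: eq_bigr => j _; rewrite expr2.
  have := set_partition_big (op := +%R) _ (E := fun j => grad f y 0 j ^+ 2) Ipart.
  (* Injectivity of [I] turns the sum over the set of blocks into a sum over the [n] indices. *)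
  rewrite big_imset /=; last by move=> ? ? _ _; exact: Iinj.
  by move=> <-; apply: eq_bigl => j; rewrite inE.
rewrite (le_trans (ler_sum _ (fun j _ => imax j Logic.I))) //.
by rewrite sumr_const card_ord mulr_natl.
Qed.

(** The minimizer does at least as well as the gradient step [y - p / L], where [p] is the gradient
    with the coordinates outside block [i] set to zero. *)
Lemma block_min_decrease (f : 'rV[R]_N -> R) (L : R) i y x' :
  (forall x, differentiable f x) -> lipschitz_grad L f -> 0 < L ->
  argmin (block_space I i y) f x' ->
  f x' <= f y - (2 * L)^-1 * norm2 (block_grad I i f y) ^+ 2.
Proof.
move=> hdiff hlip L0 [_ xmin].
pose p : 'rV[R]_N := \row_j (if j \in I i then grad f y 0 j else 0).
have gp : dotv (grad f y) p = norm2 (block_grad I i f y) ^+ 2.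
  rewrite sqr_norm2_block_grad [RHS]big_mkcond; apply: eq_bigr => j _.
  by rewrite [p 0 j]mxE; case: ifP => _; rewrite ?mulr0 ?expr2.
have pp : dotv p p = norm2 (block_grad I i f y) ^+ 2.
  rewrite sqr_norm2_block_grad [RHS]big_mkcond; apply: eq_bigr => j _.
  by rewrite [p 0 j]mxE; case: ifP => _; rewrite ?mulr0 ?expr2.
have pS : block_space I i y (y + (- L^-1) *: p).
  rewrite /block_space /= addrAC subrr add0r rpredZ // (row_sum_delta p).
  apply: rpred_sum => j _; rewrite mxE; case: ifP => jI; last first.
    by rewrite scale0r rpred0.
  by rewrite rpredZ // memv_span // map_f // mem_enum.
apply: le_trans (xmin _ pS) _.
apply: le_trans (descent_upper hdiff hlip _ _) _.
rewrite !dotvE gp pp le_eqVlt; apply/orP; left; apply/eqP.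
by field; rewrite gt_eqF.
Qed.

End Blocks.

(** Used with the block index chosen at an iteration as the witness that blocks exist. *)
Lemma natr_ord_gt0 (R : numDomainType) (n : nat) (i : 'I_n) : 0 < n%:R :> R.
Proof. by rewrite ltr0n; case: n i => [[]|]. Qed.

(** * Quadratics as estimate functions *)

Section EstimateSequence.
Context {R : realType} {N : nat}.
Implicit Types (q : 'rV[R]_N -> R) (v : 'rV[R]_N).

(** The Hessian is [tau] times the identity. The affine part stays existential, so an update of
    [psi] only has to track the curvature. *)
Definition quadratic (tau : R) q : Prop :=
  exists c b, forall z, q z = c + dotv b z + tau / 2 * dotv z z.

Lemma quadratic_sqr_dist (x0 : 'rV[R]_N) :
  quadratic 1 (fun z => 2^-1 * norm2 (z - x0) ^+ 2).
Proof.
exists (2^-1 * dotv x0 x0), (- x0) => z.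
by rewrite sqr_norm2 !dotvE (dotvC z x0); field.
Qed.

Lemma quadratic_add (tau mu a c : R) q g y : quadratic tau q ->
  quadratic (tau + mu * a)
    (fun z => q z + a * (c + dotv g (z - y) + mu / 2 * norm2 (z - y) ^+ 2)).
Proof.
move=> [c' [b qE]].
exists (c' + a * (c - dotv g y + mu / 2 * dotv y y)), (b + a *: (g - mu *: y)).
by move=> z; rewrite qE sqr_norm2 !dotvE (dotvC z y); field.
Qed.

Lemma quadratic_argmin (tau : R) q v : 0 < tau -> quadratic tau q ->
  argmin [set: 'rV[R]_N] q v ->
  forall z, q z = q v + tau / 2 * norm2 (z - v) ^+ 2.
Proof.
move=> tau0 [c [b qE]] [_ vmin].
have tau_neq0 : tau != 0 by rewrite gt_eqF.
set r := b + tau *: v.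
have qD w : q (v + w) = q v + dotv r w + tau / 2 * dotv w w.
  by rewrite !qE /r !dotvE (dotvC w v); field.
have r0 : r = 0.
  apply: dotv_eq0; apply/eqP; rewrite eq_le dotv_ge0 andbT.
  (* [r] is the gradient of [q] at [v]; this test point would lower [q] by [|r|^2 / (2 tau)]. *)
  have := vmin (v + (- tau^-1) *: r) Logic.I.
  rewrite qD !dotvZr dotvZl => h.
  have {h} : 0 <= - (2 * tau)^-1 * dotv r r.
    suff -> : - (2 * tau)^-1 * dotv r r = - tau^-1 * dotv r r +
      tau / 2 * (- tau^-1 * (- tau^-1 * dotv r r)) by lra.
    by field.
  by rewrite mulNr oppr_ge0 pmulr_rle0 // invr_gt0 mulr_gt0.
move=> z; rewrite -{1}(subrK v z) addrC qD r0 sqr_norm2.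
by rewrite -(scale0r r) dotvZl mul0r addr0.
Qed.

(* Completing the square: twice [tau + mu a] times the slack is the squared norm
   of [(tau + mu a) (z - v) + a g + a mu (v - y)]. *)
Lemma estimate_lower_bound (tau mu a : R) (g v y z : 'rV[R]_N) :
  0 < tau + mu * a ->
  a * tau / (tau + mu * a) * dotv g (v - y)
    + mu * tau * a / (2 * (tau + mu * a)) * norm2 (v - y) ^+ 2
    - a ^+ 2 / (2 * (tau + mu * a)) * norm2 g ^+ 2
  <= tau / 2 * norm2 (z - v) ^+ 2
     + a * (dotv g (z - y) + mu / 2 * norm2 (z - y) ^+ 2).
Proof.
move=> T0; rewrite -subr_ge0.
have T_neq0 : tau + mu * a != 0 by rewrite gt_eqF.
set w := (tau + mu * a) *: (z - v) + a *: g + (a * mu) *: (v - y).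
set D := (X in 0 <= X).
suff -> : D = (2 * (tau + mu * a))^-1 * dotv w w.
  by rewrite mulr_ge0 ?dotv_ge0 // invr_ge0 mulr_ge0 // ltW.
rewrite /D /w !sqr_norm2 !dotvE.
rewrite !(dotvC _ g) !(dotvC _ y) (dotvC z v).
by field.
Qed.

End EstimateSequence.

(** * One iteration of the method *)

Section Step.
Context {R : realType} {N n : nat} {I : 'I_n -> {set 'I_N}}.
Context {f : 'rV[R]_N -> R} {L mu : R} {rule : step_rule}.
Context {s : aam_trace R N n} {k : nat}.
Hypotheses (hI : block_partition I) (hL : 0 < L) (hmu : 0 <= mu).
Hypotheses (hdiff : forall x, differentiable f x) (hlip : lipschitz_grad L f).
Hypothesis hstep : aam_step I rule f L mu s k.
Hypotheses (A_ge0 : 0 <= aam_A s k) (tau_gt0 : 0 < aam_tau s k).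

Local Notation g := (grad f (aam_y s k)).
Local Notation a := (aam_a s k.+1).
Local Notation A := (aam_A s k.+1).
Local Notation tau := (aam_tau s k.+1).
Local Notation Ln := (L * n%:R).

Let Ln_gt0 : 0 < Ln. Proof. by rewrite mulr_gt0 ?(natr_ord_gt0 _ (aam_i s k)). Qed.

Lemma aam_step_A_gt0 : 0 < A.
Proof. by rewrite (aam_step_A hstep) ltr_wpDl // (aam_step_a_gt0 hstep). Qed.

Lemma aam_step_tau_gt0 : 0 < tau.
Proof.
rewrite (aam_step_tau hstep) ltr_wpDr // mulr_ge0 // ltW //.
exact: (aam_step_a_gt0 hstep).
Qed.

(** The factor [n] of the rate enters here: the greedy block carries at least a fraction [1 / n] of
    the squared gradient norm. *)
Lemma aam_step_block_decrease :
  f (aam_x s k.+1) <= f (aam_y s k) - (2 * Ln)^-1 * norm2 g ^+ 2.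
Proof.
apply: le_trans (block_min_decrease hdiff hlip hL (aam_step_x hstep)) _.
rewrite lerD2l lerN2.
have -> : (2 * Ln)^-1 = (2 * L)^-1 / n%:R by rewrite mulrA invfM.
rewrite -mulrA ler_pM2l ?invr_gt0 ?mulr_gt0 // ler_pdivrMl ?(natr_ord_gt0 _ (aam_i s k)) //.
exact: sqr_norm2_grad_le hI (aam_step_i hstep).
Qed.

(** An equality when [L] is known. Otherwise, compare the step equation with the block decrease,
    drop its nonnegative [mu] term and cancel [|g|^2 > 0]. *)
Lemma aam_step_size : A * tau <= Ln * a ^+ 2.
Proof.
have A0 := aam_step_A_gt0; have T0 := aam_step_tau_gt0.
have a0 := aam_step_a_gt0 hstep.
have AT0 : 0 < A * tau by rewrite mulr_gt0.
suff : Ln^-1 <= a ^+ 2 / (A * tau).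
  by rewrite ler_pdivlMr // ler_pdivrMl.
have := aam_step_a hstep; rewrite /step_size_eq -(aam_step_A hstep).
rewrite -(aam_step_tau hstep); case: rule => [->|[g_neq0 fE]].
  by rewrite div1r.
have g0 : 0 < norm2 g ^+ 2.
  rewrite sqr_norm2 lt_def dotv_ge0 andbT; apply/eqP => /dotv_eq0.
  exact: g_neq0.
have := aam_step_block_decrease; rewrite -fE => h.
have p0 : 0 <= mu * aam_tau s k * a / (2 * A * tau)
    * norm2 (aam_v s k - aam_y s k) ^+ 2.
  by rewrite mulr_ge0 ?sqr_ge0 // divr_ge0 ?mulr_ge0 // ltW.
have {h p0} : (2 * Ln)^-1 * norm2 g ^+ 2 <= a ^+ 2 / (2 * A * tau) * norm2 g ^+ 2.
  lra.
rewrite ler_pM2r // -(ler_pM2l (@ltr0n R 2)).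
have -> : 2 * (2 * Ln)^-1 = Ln^-1 by rewrite invfM mulVKf ?pnatr_eq0.
suff -> : 2 * (a ^+ 2 / (2 * A * tau)) = a ^+ 2 / (A * tau) by [].
by field; rewrite !gt_eqF.
Qed.

(** Common form of both rules: for unknown [L] it is the step equation times [A]; for known [L] it
    is the block decrease weakened by the nonnegative [mu] term. *)
Lemma aam_step_decrease : A * f (aam_x s k.+1) <=
  A * f (aam_y s k) - a ^+ 2 / (2 * tau) * norm2 g ^+ 2
    + mu * aam_tau s k * a / (2 * tau) * norm2 (aam_v s k - aam_y s k) ^+ 2.
Proof.
have A0 := aam_step_A_gt0; have T0 := aam_step_tau_gt0.
have a0 := aam_step_a_gt0 hstep.
have := aam_step_a hstep; rewrite /step_size_eq -(aam_step_A hstep).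
rewrite -(aam_step_tau hstep); case: rule => [aE|[_ <-]]; last first.
  rewrite le_eqVlt; apply/orP; left; apply/eqP.
  by field; rewrite !gt_eqF.
have := aam_step_block_decrease.
have -> : (2 * Ln)^-1 = a ^+ 2 / (A * tau) / 2 by rewrite aE div1r invfM mulrC.
rewrite -(ler_pM2l A0) => /le_trans; apply.
have p0 : 0 <= mu * aam_tau s k * a / (2 * tau)
    * norm2 (aam_v s k - aam_y s k) ^+ 2.
  by rewrite mulr_ge0 ?sqr_ge0 // divr_ge0 ?mulr_ge0 // ltW.
suff -> : A * (f (aam_y s k) - a ^+ 2 / (A * tau) / 2 * norm2 g ^+ 2) =
  A * f (aam_y s k) - a ^+ 2 / (2 * tau) * norm2 g ^+ 2 by lra.
by field; rewrite !gt_eqF.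
Qed.

Lemma aam_line_search_le : f (aam_y s k) <= f (aam_x s k).
Proof.
have [_ /(_ 0)] := aam_step_beta hstep.
by rewrite /= lexx ler01 scale0r addr0 -(aam_step_y hstep); apply.
Qed.

(* [v - y] is a nonnegative multiple of [v - x], so moving from [y] towards [v]
   stays on the segment over which [y] minimizes [f]; this covers the boundary
   values of [beta] as well. *)
Lemma aam_line_search_dotv : 0 <= dotv g (aam_v s k - aam_y s k).
Proof.
apply: (line_min_dotv_ge0 hdiff hlip) => t /andP[t0 t1].
have [/andP[b0 b1] bmin] := aam_step_beta hstep.
have := bmin (aam_beta s k + t * (1 - aam_beta s k)).
rewrite -(aam_step_y hstep) => /(_ _)/le_trans; apply; first by rewrite /=; nra.
rewrite le_eqVlt (aam_step_y hstep); apply/orP; left; apply/eqP; congr f.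
by apply/rowP => j; rewrite !mxE; ring.
Qed.

(** The bound from completing the square has the same gradient and distance terms as
    [aam_step_decrease]. Its extra inner product is nonnegative, and [f (y^k) <= f (x^k)] raises the
    weight of [f (y^k)] from [a] to [A]. *)
Lemma aam_estimate_step :
  quadratic (aam_tau s k) (aam_psi s k) ->
  argmin [set: 'rV[R]_N] (aam_psi s k) (aam_v s k) ->
  aam_A s k * f (aam_x s k) <= aam_psi s k (aam_v s k) ->
  A * f (aam_x s k.+1) <= aam_psi s k.+1 (aam_v s k.+1).
Proof.
move=> psiQ vmin IH; apply: le_trans aam_step_decrease _.
rewrite (aam_step_psi hstep) (quadratic_argmin tau_gt0 psiQ vmin).
have := aam_step_tau_gt0; rewrite (aam_step_tau hstep).
move=> /(estimate_lower_bound g (aam_v s k) (aam_y s k) (aam_v s k.+1)).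
have : 0 <= a * aam_tau s k / (aam_tau s k + mu * a)
    * dotv g (aam_v s k - aam_y s k).
  rewrite mulr_ge0 ?aam_line_search_dotv // -(aam_step_tau hstep).
  by rewrite divr_ge0 ?mulr_ge0 // ltW // ?aam_step_tau_gt0 ?(aam_step_a_gt0 hstep).
have := ler_wpM2l A_ge0 aam_line_search_le.
rewrite (aam_step_A hstep); lra.
Qed.

End Step.

(** * Whole runs: the gap estimate and the growth of [A] *)

Section Run.
Context {R : realType} {N n : nat} {I : 'I_n -> {set 'I_N}}.
Context {f : 'rV[R]_N -> R} {L mu : R} {rule : step_rule}.
Context {x0 : 'rV[R]_N} {s : aam_trace R N n} {K : nat}.
Hypotheses (hI : block_partition I) (hL : 0 < L) (hmu : 0 <= mu).
Hypotheses (hdiff : forall x, differentiable f x) (hlip : lipschitz_grad L f).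
Hypothesis hrun : aam_run I rule f L mu x0 s K.

Local Notation Ln := (L * n%:R).

Lemma aam_run_A_ge0 j : (j <= K)%N -> 0 <= aam_A s j.
Proof.
case: hrun => -[_ _ A0 _ _] hst; elim: j => [|j IH] jK; first by rewrite A0.
exact: ltW (aam_step_A_gt0 (hst j jK) (IH (ltnW jK))).
Qed.

Lemma aam_run_tau j : (j <= K)%N -> aam_tau s j = 1 + mu * aam_A s j.
Proof.
case: hrun => -[_ _ A0 tau0 _] hst.
elim: j => [|j IH] jK; first by rewrite A0 tau0 mulr0 addr0.
have st := hst j jK.
by rewrite (aam_step_tau st) (aam_step_A st) IH 1?ltnW // mulrDr addrA.
Qed.

Lemma aam_run_tau_gt0 j : (j <= K)%N -> 0 < aam_tau s j.
Proof.
move=> jK; rewrite aam_run_tau // ltr_wpDr // mulr_ge0 //.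
exact: aam_run_A_ge0.
Qed.

Lemma aam_run_quadratic j : (j <= K)%N -> quadratic (aam_tau s j) (aam_psi s j).
Proof.
case: hrun => -[_ _ _ tau0 psi0] hst; elim: j => [|j IH] jK.
  by rewrite tau0 (funext psi0); exact: quadratic_sqr_dist.
have st := hst j jK; rewrite (funext (aam_step_psi st)) (aam_step_tau st).
exact/quadratic_add/IH/ltnW.
Qed.

Lemma aam_run_argmin j : (j <= K)%N ->
  argmin [set: 'rV[R]_N] (aam_psi s j) (aam_v s j).
Proof.
case: hrun => -[_ v0 _ _ psi0] hst; case: j => [|j] jK.
  (* [v^0] is set to [x^0] rather than chosen as a minimizer, so the case [j = 0] is checked by
     hand. *)
  split=> // w _; rewrite !psi0 v0 subrr !sqr_norm2 -(scale0r 0) dotvZl mul0r.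
  by rewrite mulr0 mulr_ge0 ?dotv_ge0.
exact: (aam_step_v (hst j jK)).
Qed.

Lemma aam_run_estimate_lower j : (j <= K)%N ->
  aam_A s j * f (aam_x s j) <= aam_psi s j (aam_v s j).
Proof.
case: hrun => -[_ _ A0 _ psi0] hst; elim: j => [|j IH] jK.
  by rewrite A0 mul0r psi0 sqr_norm2 mulr_ge0 ?dotv_ge0.
have jK' := ltnW jK.
apply: (aam_estimate_step hI hL hmu hdiff hlip (hst j jK)).
- exact: aam_run_A_ge0.
- exact: aam_run_tau_gt0.
- exact: aam_run_quadratic.
- exact: aam_run_argmin.
- exact: IH.
Qed.

(** Each update adds [a] times a minorant of [f], by [strongly_convex_lower]. *)
Lemma aam_run_estimate_upper j z : strongly_convex mu f -> (j <= K)%N ->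
  aam_psi s j z <= aam_A s j * f z + 2^-1 * norm2 (z - x0) ^+ 2.
Proof.
move=> hconv; case: hrun => -[_ _ A0 _ psi0] hst; elim: j => [|j IH] jK.
  by rewrite A0 mul0r add0r psi0.
have st := hst j jK; rewrite (aam_step_psi st) (aam_step_A st).
have := ler_wpM2l (ltW (aam_step_a_gt0 st))
  (strongly_convex_lower hdiff hlip hconv (aam_y s j) z).
have := IH (ltnW jK); lra.
Qed.

Lemma aam_run_gap j z : strongly_convex mu f -> (j <= K)%N ->
  aam_A s j * (f (aam_x s j) - f z) <= 2^-1 * norm2 (z - x0) ^+ 2.
Proof.
move=> hconv jK; rewrite mulrBr lerBlDl.
apply: le_trans (aam_run_estimate_lower jK) _.
apply: le_trans ((aam_run_argmin jK).2 z Logic.I) _.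
exact: aam_run_estimate_upper.
Qed.

Lemma aam_run_step_size j : (j < K)%N ->
  aam_A s j.+1 * (1 + mu * aam_A s j.+1) <= Ln * aam_a s j.+1 ^+ 2.
Proof.
move=> jK; rewrite -aam_run_tau //; have jK' := ltnW jK.
apply: (aam_step_size hI hL hmu hdiff hlip (hrun.2 j jK)).
- exact: aam_run_A_ge0.
- exact: aam_run_tau_gt0.
Qed.

(* [r = sqrt (L n A_j)] grows by at least [1/2] per step, because
   [r'^2 - r^2 = L n a >= r']. *)
Lemma aam_run_A_quadratic_growth j : (j <= K)%N ->
  j%:R / 2 <= Num.sqrt (Ln * aam_A s j).
Proof.
elim: j => [|j IH] jK; first by rewrite mul0r sqrtr_ge0.
have {}IH := IH (ltnW jK); have st := hrun.2 j jK.
have M0 : 0 < Ln by rewrite mulr_gt0 // (natr_ord_gt0 _ (aam_i s j)).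
have A0 := aam_run_A_ge0 (ltnW jK); have A1 := aam_step_A_gt0 st A0.
have a0 := aam_step_a_gt0 st.
set r := Num.sqrt (Ln * aam_A s j) in IH *.
set r' := Num.sqrt (Ln * aam_A s j.+1).
have r0 : 0 <= r := sqrtr_ge0 _.
have r'0 : 0 < r' by rewrite sqrtr_gt0 mulr_gt0.
have r2 : r ^+ 2 = Ln * aam_A s j by rewrite sqr_sqrtr // mulr_ge0 // ltW.
have r'2 : r' ^+ 2 = Ln * aam_A s j.+1 by rewrite sqr_sqrtr // mulr_ge0 // ltW.
have ra : r' ^+ 2 - r ^+ 2 = Ln * aam_a s j.+1.
  by rewrite r2 r'2 (aam_step_A st); ring.
have r'a : r' <= Ln * aam_a s j.+1.
  rewrite -(@ler_pXn2r _ 2) ?nnegrE ?(mulr_ge0 (ltW M0) (ltW a0)) ?(ltW r'0) //.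
  rewrite r'2 (_ : (Ln * _) ^+ 2 = Ln * (Ln * aam_a s j.+1 ^+ 2)); last by ring.
  rewrite ler_pM2l //.
  apply: le_trans (aam_run_step_size jK).
  by rewrite ler_peMr ?(ltW A1) // lerDl mulr_ge0 // ltW.
suff : r + 1 / 2 <= r' by have := @natr1 R j; lra.
(* If [r' < r + 1/2], then [r' <= r'^2 - r^2 < (r' + r) / 2], so [r' < r]; this contradicts
   [r'^2 - r^2 >= r' > 0]. *)
rewrite leNgt; apply/negP => r'r.
have S0 : 0 < r' + r by rewrite ltr_wpDr.
have : 0 < (r + 1 / 2 - r') * (r' + r) by rewrite mulr_gt0 // subr_gt0.
move=> h1; have rr' : r' < r by lra.
have : 0 < (r - r') * (r' + r) by rewrite mulr_gt0 // subr_gt0.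
lra.
Qed.

(** Keeping only [mu A^2] in the step size bound gives [q A <= a] for the new [A] and [a].
    Subtracting from [A] gives the contraction, and [a <= A] gives [q <= 1]. *)
Lemma aam_run_A_linear_step j : (j < K)%N ->
  let q := Num.sqrt (mu / (n%:R * L)) in
  q <= 1 /\ aam_A s j <= (1 - q) * aam_A s j.+1.
Proof.
move=> jK q; have st := hrun.2 j jK.
have n0 : 0 < n%:R :> R := natr_ord_gt0 _ (aam_i s j).
have A0 := aam_run_A_ge0 (ltnW jK); have A1 := aam_step_A_gt0 st A0.
have a0 := aam_step_a_gt0 st; have AE := aam_step_A st.
have qA : q * aam_A s j.+1 <= aam_a s j.+1.
  have q0 : 0 <= q := sqrtr_ge0 _.
  rewrite -(@ler_pXn2r _ 2) ?nnegrE ?mulr_ge0 ?(ltW A1) ?(ltW a0) //.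
  rewrite exprMn sqr_sqrtr; last by rewrite divr_ge0 // mulr_ge0 // ltW.
  rewrite mulrAC ler_pdivrMr ?mulr_gt0 //.
  have := aam_run_step_size jK; nra.
by split; last (rewrite mulrBl mul1r; lra); rewrite -(ler_pM2r A1) mul1r; lra.
Qed.

(** The contraction starts from [A_1 = a_1], where the step size bound reads
    [1 + mu a_1 <= L n a_1]; hence the exponent [k - 1] in the rate. *)
Lemma aam_run_A_linear_growth j : (j < K)%N ->
  1 <= Ln * aam_A s j.+1 * (1 - Num.sqrt (mu / (n%:R * L))) ^+ j.
Proof.
elim: j => [|j IH] jK; have st := hrun.2 _ jK.
  have := aam_run_step_size jK; have a0 := aam_step_a_gt0 st.
  have -> : aam_A s 1 = aam_a s 1.
    by rewrite (aam_step_A st); case: hrun => -[_ _ -> _ _] _; rewrite add0r.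
  rewrite expr0 mulr1 expr2 mulrCA ler_pM2l // => h.
  by apply: le_trans h; rewrite lerDl mulr_ge0 // ltW.
apply: le_trans (IH (ltnW jK)) _.
have [q1 qA] := aam_run_A_linear_step jK.
rewrite exprS mulrA ler_wpM2r ?exprn_ge0 ?subr_ge0 // -!mulrA.
by rewrite ler_pM2l // ler_pM2l ?(natr_ord_gt0 _ (aam_i s j)) // mulrC.
Qed.

End Run.

Theorem mainTheorem2 (R : realType) (N n : nat) (I : 'I_n -> {set 'I_N})
    (f : 'rV[R]_N -> R) (L mu : R) (rule : step_rule)
    (x0 xstar : 'rV[R]_N) (s : aam_trace R N n) (k : nat)
    (hI : block_partition I)
    (hL : 0 < L) (hmu : 0 <= mu)
    (hdiff : forall x, differentiable f x)
    (hlip : lipschitz_grad L f)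
    (hconv : strongly_convex mu f)
    (hmin : forall i x, argmin (block_space I i x) f !=set0)
    (hxstar : argmin [set: 'rV[R]_N] f xstar)
    (hk : (1 <= k)%N)
    (hrun : aam_run I rule f L mu x0 s k) :
  f (aam_x s k) - f xstar <=
    n%:R * L * norm2 (xstar - x0) ^+ 2 *
      Num.min (4 / k%:R ^+ 2) ((1 - Num.sqrt (mu / (n%:R * L))) ^+ (k - 1)).
Proof.
have R0 := aam_run_gap hI hL hmu hdiff hlip hrun xstar hconv (leqnn k).
have D0 : 0 <= f (aam_x s k) - f xstar by rewrite subr_ge0 hxstar.2.
case: k hk hrun R0 D0 => // j _ hrunj; rewrite subn1 /=.
set D := _ - _; set A := aam_A s j.+1; set r2 := norm2 _ ^+ 2 => R0 D0.
have st := hrunj.2 j (ltnSn j).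
have n0 : 0 < n%:R :> R := natr_ord_gt0 _ (aam_i s j).
have A0 : 0 < A := aam_step_A_gt0 st (aam_run_A_ge0 hrunj (leqnSn j)).
(* Either member of the minimum can serve as [e]. The gap bound [A * D <= r2 / 2] leaves a factor 2
   to spare. *)
have bound e : 1 <= L * n%:R * A * e -> D <= n%:R * L * r2 * e.
  move=> e1.
  have e0 : 0 < e by rewrite -(@pmulr_rgt0 _ (L * n%:R * A)) ?(lt_le_trans ltr01 e1) ?mulr_gt0.
  apply: le_trans (ler_peMl D0 e1) _.
  have r20 : 0 <= r2 := sqr_ge0 _.
  have -> : L * n%:R * A * e * D = n%:R * L * e * (A * D) by ring.
  rewrite [leRHS]mulrAC ler_wpM2l ?mulr_ge0 ?(ltW e0) ?(ltW hL) ?(ltW n0) //; lra.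
rewrite /Num.min; case: ifP => _; apply: bound; last first.
  exact: (aam_run_A_linear_growth hI hL hmu hdiff hlip hrunj).
(* Squaring [k / 2 <= sqrt (L n A)] produces the constant 4. *)
have := aam_run_A_quadratic_growth hI hL hmu hdiff hlip hrunj (leqnn j.+1).
rewrite -/A -(@ler_pXn2r _ 2) ?nnegrE ?sqrtr_ge0 ?divr_ge0 // sqr_sqrtr.
  move=> h; rewrite mulrA ler_pdivlMr ?exprn_gt0 // mul1r.
  rewrite expr_div_n in h; lra.
by rewrite ltW // !mulr_gt0.
Qed.
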